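(* Let $S$ be a $\Gamma$-semiring with zero and with unities. Then $FLI(S)$ and $FRI(S)$, each with addition $\oplus$ (sum) and multiplication $\circ$ (composition), are both zero-sum free hemirings having infinite element $\mathbf{1}$, where $\mathbf{1}(x)=1$ for all $x\in S$. (The additive identity of each hemiring is $\theta$, where $\theta(0)=1$ and $\theta(x)=0$ for $x\ne0$.)
   Context: Let $S$ and $\Gamma$ be additive commutative semigroups. $S$ is a $\Gamma$-semiring if there is a map $S\times\Gamma\times S\to S$, $(a,\alpha,b)\mapsto a\alpha b$, with $(a+b)\alpha c=a\alpha c+b\alpha c$, $a\alpha(b+c)=a\alpha b+a\alpha c$, $a(\alpha+\beta)b=a\alpha b+a\beta b$, $a\alpha(b\beta c)=(a\alpha b)\beta c$ for all $a,b,c\in S$, $\alpha,\beta\in\Gamma$. It is with zero if $(S,+)$ and $(\Gamma,+)$ are monoids with identities $0_S,0_\Gamma$ (both written $0$) and $0_S\alpha x=0_S=x\alpha 0_S$, $x0_\Gamma y=0_S=y0_\Gamma x$ for all $x,y\in S$, $\alpha\in\Gamma$. It is with unities if there are finite families $e_i\in S,\delta_i\in\Gamma$ with $\sum_i e_i\delta_i x=x$ for all $x\in S$ (left unity) and finite families $\nu_j\in\Gamma,f_j\in S$ with $\sum_j x\nu_j f_j=x$ for all $x\in S$ (right unity). A fuzzy subset of $S$ is a map $\mu:S\to[0,1]$; it is non empty if $\mu(x)\neq0$ for some $x$. A fuzzy left ideal (resp. fuzzy right ideal) of $S$ is a non empty fuzzy subset $\mu$ with $\mu(x+y)\ge\min[\mu(x),\mu(y)]$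 and $\mu(x\gamma y)\ge\mu(y)$ (resp. $\mu(x\gamma y)\ge\mu(x)$) for all $x,y\in S,\gamma\in\Gamma$. Convention: all fuzzy left ideals and fuzzy right ideals $\mu$ are assumed to satisfy $\mu(0)=1$. $FLI(S)$, $FRI(S)$ denote the sets of all fuzzy left ideals, fuzzy right ideals of $S$ (with this convention). The sum is $(\mu_1\oplus\mu_2)(x)=\sup\{\min[\mu_1(u),\mu_2(v)] : u,v\in S,\ x=u+v\}$. The composition is $(\mu_1\circ\mu_2)(x)=\sup\{\min_{1\le i\le n}\min[\mu_1(u_i),\mu_2(v_i)] : n\ge1,\ u_i,v_i\in S,\ \gamma_i\in\Gamma,\ x=\sum_{i=1}^n u_i\gamma_i v_i\}$, and $0$ if $x$ has no such representation. A hemiring is a non empty set $H$ with operations $+,\cdot$ such that $(H,+)$ is a commutative monoid with identity $0$, $(H,\cdot)$ is a semigroup, both distributive laws hold, and $a\cdot0=0\cdot a=0$ for all $a\in H$ (a multiplicative identity is not required). A hemiring $H$ is zero-sum free if $a+b=0$ implies $a=b=0$ for all $a,b\in H$. An element $a\in H$ is infinite if $a+s=a$ for all $s\in H$. *)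

(* Defs.v *)
From mathcomp Require Import all_boot all_order all_algebra.
From mathcomp Require Import all_classical all_reals.

Set Implicit Arguments.
Unset Strict Implicit.
Unset Printing Implicit Defensive.

Import Order.TTheory GRing.Theory Num.Theory.
Local Open Scope classical_set_scope.
Local Open Scope ring_scope.

(** * Gamma-semirings *)

(* [op a al b] stands for the product [a al b].  In MathComp, [addSemigroupType]
   (resp. [nmodType]) is a commutative additive semigroup (resp. monoid). *)
Record gamma_semiring (S G : addSemigroupType) (op : S -> G -> S -> S) : Prop :=
  GammaSemiring {
    gamma_opDl : forall a b al c, op (a + b) al c = op a al c + op b al c;
    gamma_opDr : forall a al b c, op a al (b + c) = op a al b + op a al c;
    gamma_opDm : forall a al be b, op a (al + be) b = op a al b + op a be b;
    gamma_opA : forall a al b be c, op a al (op b be c) = op (op a al b) be c }.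

Record gamma_semiring_with_zero (S G : nmodType) (op : S -> G -> S -> S) : Prop :=
  GammaSemiringWithZero {
    gamma_with_zero_semiring : gamma_semiring op;
    gamma_op0l : forall al x, op 0 al x = 0;
    gamma_op0r : forall al x, op x al 0 = 0;
    gamma_op0m : forall x y, op x 0 y = 0 }.

Definition has_left_unity (S G : nmodType) (op : S -> G -> S -> S) : Prop :=
  exists (n : nat) (e : 'I_n -> S) (d : 'I_n -> G),
    forall x, \sum_(i < n) op (e i) (d i) x = x.

Definition has_right_unity (S G : nmodType) (op : S -> G -> S -> S) : Prop :=
  exists (m : nat) (nu : 'I_m -> G) (f : 'I_m -> S),
    forall x, \sum_(j < m) op x (nu j) (f j) = x.

Definition with_unities (S G : nmodType) (op : S -> G -> S -> S) : Prop :=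
  has_left_unity op /\ has_right_unity op.

(** * Fuzzy ideals *)

Definition fuzzy_subset (R : realType) (S : Type) (mu : S -> R) : Prop :=
  forall x, 0 <= mu x <= 1.

Definition fuzzy_nonempty (R : realType) (S : Type) (mu : S -> R) : Prop :=
  exists x, mu x <> 0.

Record fuzzy_left_ideal (R : realType) (S G : nmodType) (op : S -> G -> S -> S)
    (mu : S -> R) : Prop := FuzzyLeftIdeal {
  fli_fuzzy : fuzzy_subset mu;
  fli_nonempty : fuzzy_nonempty mu;
  fli_add : forall x y, mu (x + y) >= Num.min (mu x) (mu y);
  fli_mul : forall x c y, mu (op x c y) >= mu y }.

Record fuzzy_right_ideal (R : realType) (S G : nmodType) (op : S -> G -> S -> S)
    (mu : S -> R) : Prop := FuzzyRightIdeal {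
  fri_fuzzy : fuzzy_subset mu;
  fri_nonempty : fuzzy_nonempty mu;
  fri_add : forall x y, mu (x + y) >= Num.min (mu x) (mu y);
  fri_mul : forall x c y, mu (op x c y) >= mu x }.

Definition FLI (R : realType) (S G : nmodType) (op : S -> G -> S -> S) :
    set (S -> R) :=
  [set mu | fuzzy_left_ideal op mu /\ mu 0 = 1].

Definition FRI (R : realType) (S G : nmodType) (op : S -> G -> S -> S) :
    set (S -> R) :=
  [set mu | fuzzy_right_ideal op mu /\ mu 0 = 1].

Definition fuzzy_sum (R : realType) (S : nmodType) (mu1 mu2 : S -> R) : S -> R :=
  fun x => sup [set r | exists u v : S,
    x = u + v /\ r = Num.min (mu1 u) (mu2 v)].

(* The families are indexed by ['I_n.+1], so they are nonempty; the seed 1 of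
   the iterated minimum is harmless because fuzzy subsets are bounded by 1.  If
   [x] has no representation, the value is [sup set0 = 0] (lemma [sup0]). *)
Definition fuzzy_comp (R : realType) (S G : nmodType) (op : S -> G -> S -> S)
    (mu1 mu2 : S -> R) : S -> R :=
  fun x => sup [set r | exists (n : nat) (u v : 'I_n.+1 -> S) (c : 'I_n.+1 -> G),
    x = \sum_(i < n.+1) op (u i) (c i) (v i) /\
    r = \big[Num.min/1]_(i < n.+1) Num.min (mu1 (u i)) (mu2 (v i))].

Definition fuzzy_theta (R : realType) (S : nmodType) : S -> R :=
  fun x => if x == 0 then 1 else 0.

Definition fuzzy_one (R : realType) (S : nmodType) : S -> R := fun=> 1.

Arguments FLI R {S G} op _.
Arguments FRI R {S G} op _.
Arguments fuzzy_sum R S mu1 mu2 x : clear implicits.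
Arguments fuzzy_comp R {S G} op mu1 mu2 x.
Arguments fuzzy_theta R S x : clear implicits.
Arguments fuzzy_one R S x : clear implicits.

(** * Hemirings *)

(* The carrier is a subset [H] of a type, so closure under the operations is
   part of the definition; [hemiring_zero] makes [H] nonempty.  MathComp's
   semirings cannot be used here because they require a multiplicative unit. *)
Record hemiring (T : Type) (H : set T) (add mul : T -> T -> T) (zero : T) : Prop :=
  Hemiring {
    hemiring_zero : H zero;
    hemiring_add : forall a b, H a -> H b -> H (add a b);
    hemiring_mul : forall a b, H a -> H b -> H (mul a b);
    hemiring_addA : forall a b c, H a -> H b -> H c ->
      add a (add b c) = add (add a b) c;
    hemiring_addC : forall a b, H a -> H b -> add a b = add b a;
    hemiring_add0 : forall a, H a -> add zero a = a;
    hemiring_mulA : forall a b c, H a -> H b -> H c ->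
      mul a (mul b c) = mul (mul a b) c;
    hemiring_mulDl : forall a b c, H a -> H b -> H c ->
      mul (add a b) c = add (mul a c) (mul b c);
    hemiring_mulDr : forall a b c, H a -> H b -> H c ->
      mul a (add b c) = add (mul a b) (mul a c);
    hemiring_mul0l : forall a, H a -> mul zero a = zero;
    hemiring_mul0r : forall a, H a -> mul a zero = zero }.

Definition zero_sum_free (T : Type) (H : set T) (add : T -> T -> T) (zero : T) :
    Prop :=
  forall a b, H a -> H b -> add a b = zero -> a = zero /\ b = zero.

Definition infinite_element (T : Type) (H : set T) (add : T -> T -> T) (a : T) :
    Prop :=
  H a /\ forall s, H s -> add a s = a.

(* Main.v *)
Require Import Defs.
From mathcomp Require Import all_boot all_order all_algebra.
From mathcomp Require Import all_classical all_reals.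

(** The strict upper level sets [[set x | t < mu x]] with [0 <= t] determine a
    fuzzy subset, and they turn the fuzzy sum and composition into the sum of
    subsets and the set of finite sums of products.  Every hemiring law thus
    reduces to an identity between subsets of [S]; these identities hold as soon
    as the subsets contain [0], that is, for all fuzzy subsets with [mu 0 = 1]. *)

Set Implicit Arguments.
Unset Strict Implicit.
Unset Printing Implicit Defensive.

Import Order.TTheory GRing.Theory Num.Theory.
Local Open Scope classical_set_scope.
Local Open Scope ring_scope.

(** * Suprema of subsets of the unit interval *)

Section UnitIntervalSup.
Variable R : realType.
Implicit Types (A : set R) (t : R).

(** Strictness lets an element of [A] witness the bound even when the supremum is not attained. The
    condition [0 <= t] settles the empty set, whose [sup] is [0] by convention. *)
Lemma lt_sup_unit A t : (forall r, A r -> 0 <= r <= 1) -> 0 <= t ->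
  t < sup A <-> exists2 r, A r & t < r.
Proof.
move=> A01 t0; split=> [tA|[r Ar tr]].
  have [A0|/set0P Ane] := eqVneq A set0; last exact: sup_gt.
  by move: tA; rewrite A0 sup0 ltNge t0.
apply: lt_le_trans tr _; apply: ub_le_sup => //.
by exists 1 => s /A01 /andP[].
Qed.

Lemma sup_unit A : (forall r, A r -> 0 <= r <= 1) -> 0 <= sup A <= 1.
Proof.
move=> A01; apply/andP; split; last first.
  (* At level [t = 1], a supremum above [1] would give an element of [A] above [1]; this treats
     empty and nonempty [A] alike. *)
  rewrite leNgt; apply/negP => /(lt_sup_unit A01 ler01)[r /A01/andP[_ r1]].
  by rewrite ltNge r1.
have [->|/set0P[r Ar]] := eqVneq A set0; first by rewrite sup0.
have /andP[r0 _] := A01 _ Ar.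
apply: le_trans r0 _; apply: ub_le_sup => //.
by exists 1 => s /A01 /andP[].
Qed.

End UnitIntervalSup.

(** * Level sets of the fuzzy sum and composition *)

Section Fuzzy.
Variables (R : realType) (S G : nmodType) (op : S -> G -> S -> S).
Implicit Types (a b mu : S -> R) (A B C : set S) (t : R).

(** A common home for left and right ideals: the hemiring identities are proved once on this larger
    set and then restricted to each side. *)
Definition normal_fuzzy : set (S -> R) :=
  [set mu | fuzzy_subset mu /\ mu 0 = 1].

(** If [y < x], the hypothesis at the level [t = y] itself gives [y < y]. *)
Lemma le_level (x y : R) : 0 <= y ->
  (forall t, 0 <= t -> t < x -> t < y) -> x <= y.
Proof.
by move=> y0 xy; rewrite leNgt; apply/negP => /(xy _ y0); rewrite ltxx.
Qed.

Lemma fuzzy_ext a b : fuzzy_subset a -> fuzzy_subset b ->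
  (forall t x, 0 <= t -> t < a x <-> t < b x) -> a = b.
Proof.
move=> Fa Fb ab; apply/funext => x.
have /andP[a0 _] := Fa x; have /andP[b0 _] := Fb x.
by apply/eqP; rewrite eq_le; apply/andP; split; apply: le_level => // t t0;
  move/(ab _ _ t0).
Qed.

Lemma lt_fuzzy_theta t x : 0 <= t ->
  t < fuzzy_theta R S x <-> x = 0 /\ t < 1.
Proof.
move=> t0; rewrite /fuzzy_theta; case: eqP => [->|x0]; first by split=> [|[]].
by rewrite ltNge t0; split=> [|[]].
Qed.

Lemma fuzzy_sum_unit a b x : fuzzy_subset a -> fuzzy_subset b ->
  forall r, (exists u v : S, x = u + v /\ r = Num.min (a u) (b v)) ->
  0 <= r <= 1.
Proof.
move=> Fa Fb r [u [v [_ ->]]].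
have /andP[a0 a1] := Fa u; have /andP[b0 _] := Fb v.
by rewrite le_min a0 b0 ge_min a1.
Qed.

Lemma lt_fuzzy_sum a b t x : fuzzy_subset a -> fuzzy_subset b -> 0 <= t ->
  t < fuzzy_sum R S a b x <->
  exists u v, [/\ x = u + v, t < a u & t < b v].
Proof.
move=> Fa Fb t0; rewrite lt_sup_unit//; last exact: fuzzy_sum_unit.
split=> [[_ [u [v [-> ->]]]]|[u [v [-> au bv]]]].
  by rewrite lt_min => /andP[au bv]; exists u, v.
by exists (Num.min (a u) (b v)); [exists u, v|rewrite lt_min au bv].
Qed.

(** The additive subsemigroup generated by the products. The inductive form replaces manipulations
    of indexed families by induction, and only nonempty sums occur, as in the composition. *)
Inductive sums_of_products A B : set S :=
| sums_of_products1 u c v : A u -> B v -> sums_of_products A B (op u c v)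
| sums_of_productsD x y : sums_of_products A B x -> sums_of_products A B y ->
    sums_of_products A B (x + y).

Lemma sums_of_products_sum A B n (u v : 'I_n.+1 -> S) (c : 'I_n.+1 -> G) :
  (forall i, A (u i)) -> (forall i, B (v i)) ->
  sums_of_products A B (\sum_(i < n.+1) op (u i) (c i) (v i)).
Proof.
elim: n u v c => [|n IHn] u v c Au Bv.
  by rewrite big_ord1; apply: sums_of_products1.
rewrite big_ord_recl; apply: sums_of_productsD.
  exact: sums_of_products1.
by apply: (IHn (fun i => u (lift ord0 i)) (fun i => v (lift ord0 i))
            (fun i => c (lift ord0 i))).
Qed.

(** Links the inductive closure to the indexed families of [fuzzy_comp]; the sum constructor
    corresponds to concatenating two families. *)
Lemma sums_of_productsP A B x :
  sums_of_products A B x <->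
  exists (n : nat) (u v : 'I_n.+1 -> S) (c : 'I_n.+1 -> G),
    x = \sum_(i < n.+1) op (u i) (c i) (v i) /\
    (forall i, A (u i) /\ B (v i)).
Proof.
split=> [|[n [u [v [c [-> AB]]]]]]; last first.
  by apply: sums_of_products_sum => i; have [] := AB i.
elim=> {x} [u c v Au Bv|x y _ [n [u [v [c [-> AB]]]]]
            _ [m [u' [v' [c' [-> AB']]]]]].
  exists 0%N, (fun=> u), (fun=> v), (fun=> c).
  by rewrite big_ord1.
(* Concatenation of families of lengths [n.+1] and [m.+1]. The index bound [(n + m.+1).+1] is
   convertible to [n.+1 + m.+1], so [split] and [big_split_ord] apply, while it still has the
   successor form required of a nonempty family. *)
pose glue T (f : 'I_n.+1 -> T) (g : 'I_m.+1 -> T) (i : 'I_(n + m.+1).+1) :=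
  match @fintype.split n.+1 m.+1 i with inl j => f j | inr j => g j end.
exists (n + m.+1)%N, (glue _ u u'), (glue _ v v'), (glue _ c c'); split.
  rewrite (@big_split_ord _ _ _ n.+1 m.+1) /=; congr (_ + _).
    by apply: eq_bigr => i _; rewrite /glue (unsplitK (inl i)).
  by apply: eq_bigr => i _; rewrite /glue (unsplitK (inr i)).
by move=> i; rewrite /glue; case: fintype.split.
Qed.

Lemma fuzzy_comp_unit a b x : fuzzy_subset a -> fuzzy_subset b ->
  forall r, (exists (n : nat) (u v : 'I_n.+1 -> S) (c : 'I_n.+1 -> G),
    x = \sum_(i < n.+1) op (u i) (c i) (v i) /\
    r = \big[Num.min/1]_(i < n.+1) Num.min (a (u i)) (b (v i))) ->
  0 <= r <= 1.
Proof.
move=> Fa Fb r [n [u [v [c [_ ->]]]]]; rewrite bigmin_le_id andbT.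
apply: le_bigmin => // i _; rewrite le_min.
by have /andP[-> _] := Fa (u i); have /andP[-> _] := Fb (v i).
Qed.

Lemma lt_fuzzy_comp a b t x : fuzzy_subset a -> fuzzy_subset b -> 0 <= t ->
  t < fuzzy_comp R op a b x <->
  sums_of_products [set u | t < a u] [set v | t < b v] x.
Proof.
move=> Fa Fb t0; rewrite sums_of_productsP lt_sup_unit//; last first.
  exact: fuzzy_comp_unit.
split=> [[_ [n [u [v [c [-> ->]]]]] tr]|[n [u [v [c [-> ab]]]]]].
  exists n, u, v, c; split=> // i.
  have := lt_le_trans tr (bigmin_le_cond _ (fun i => Num.min (a (u i)) (b (v i)))
    (isT : xpredT i)).
  by rewrite lt_min => /andP[].
exists (\big[Num.min/1]_(i < n.+1) Num.min (a (u i)) (b (v i))).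
  by exists n, u, v, c.
(* The seed of the minimum requires [t < 1]. This follows from the term of index [ord0], available
   because the family is nonempty, and from the bound [a <= 1]. *)
apply: lt_bigmin => [|i _]; last by rewrite lt_min; apply/andP; exact: ab.
have [au _] := ab ord0; have /andP[_ a1] := Fa (u ord0).
exact: lt_le_trans au a1.
Qed.

Lemma sums_of_productsS A A' B B' : A `<=` A' -> B `<=` B' ->
  sums_of_products A B `<=` sums_of_products A' B'.
Proof.
move=> sA sB x; elim=> {x} [u c v Au Bv|x y _ Px _ Py].
  by apply: sums_of_products1; [exact: sA|exact: sB].
exact: sums_of_productsD.
Qed.

Hypothesis hS : gamma_semiring_with_zero op.

(** Two nested inductions in each direction: distributivity reduces sums to single products, where
    associativity of [op] regroups the factors. *)
Lemma sums_of_productsA A B C :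
  sums_of_products A (sums_of_products B C) =
  sums_of_products (sums_of_products A B) C.
Proof.
have [[opDl opDr _ opA] _ _ _] := hS.
apply/seteqP; split=> x; elim=> {x} [u c v|x y _ Px _ Py];
  try exact: sums_of_productsD.
- move=> Au; elim=> {v} [p d q Bp Cq|y z _ Py _ Pz].
    by rewrite opA; do 2?apply: sums_of_products1.
  by rewrite opDr; apply: sums_of_productsD.
- move=> ABu Cv; elim: ABu => {u} [p d q Ap Bq|y z _ Py _ Pz].
    by rewrite -opA; do 2?apply: sums_of_products1.
  by rewrite opDl; apply: sums_of_productsD.
Qed.

(** * Normal fuzzy subsets: closure under the operations, and the two constants *)

Lemma fuzzy_sum_normal a b :
  normal_fuzzy a -> normal_fuzzy b -> normal_fuzzy (fuzzy_sum R S a b).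
Proof.
move=> [Fa a0] [Fb b0].
have Fab : fuzzy_subset (fuzzy_sum R S a b).
  by move=> x; apply: sup_unit; exact: fuzzy_sum_unit.
split=> //; apply/eqP; rewrite eq_le; have /andP[s0 ->/=] := Fab 0.
apply: le_level => // t t0 t1; apply/lt_fuzzy_sum => //.
by exists 0, 0; rewrite addr0 a0 b0.
Qed.

Lemma fuzzy_comp_normal a b :
  normal_fuzzy a -> normal_fuzzy b -> normal_fuzzy (fuzzy_comp R op a b).
Proof.
move=> [Fa a0] [Fb b0].
have Fab : fuzzy_subset (fuzzy_comp R op a b).
  by move=> x; apply: sup_unit; exact: fuzzy_comp_unit.
split=> //; apply/eqP; rewrite eq_le; have /andP[s0 ->/=] := Fab 0.
apply: le_level => // t t0 t1; apply/lt_fuzzy_comp => //.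
(* Writing [0] as the product [op 0 0 0] gives it a representation whose two factors have value
   [1]. *)
rewrite -[X in sums_of_products _ _ X](gamma_op0l hS 0 0).
by apply: sums_of_products1; rewrite /= ?a0 ?b0.
Qed.

Lemma fuzzy_theta_normal : normal_fuzzy (fuzzy_theta R S).
Proof.
by split=> [x|]; rewrite /fuzzy_theta ?eqxx//; case: eqP; rewrite ?ler01 ?lexx.
Qed.

Lemma fuzzy_one_normal : normal_fuzzy (fuzzy_one R S).
Proof. by split=> // x; rewrite /fuzzy_one ler01 lexx. Qed.

(** * Hemiring laws for normal fuzzy subsets *)

Lemma fuzzy_sumC a b : fuzzy_sum R S a b = fuzzy_sum R S b a.
Proof.
apply/funext => x; congr sup; apply/seteqP.
by split=> r [u [v [-> ->]]]; exists v, u; rewrite addrC minC.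
Qed.

Lemma fuzzy_sumA a b c : normal_fuzzy a -> normal_fuzzy b -> normal_fuzzy c ->
  fuzzy_sum R S a (fuzzy_sum R S b c) = fuzzy_sum R S (fuzzy_sum R S a b) c.
Proof.
move=> Na Nb Nc.
have [[Fa _] [Fb _] [Fc _]] := And3 Na Nb Nc.
have Nbc := fuzzy_sum_normal Nb Nc; have Nab := fuzzy_sum_normal Na Nb.
have [[Fbc _] [Fab _]] := (Nbc, Nab).
have [Fl _] := fuzzy_sum_normal Na Nbc; have [Fr _] := fuzzy_sum_normal Nab Nc.
apply: fuzzy_ext => // t x t0; rewrite !lt_fuzzy_sum//; split.
  move=> [u [_ [-> au /lt_fuzzy_sum[]// v [w [-> bv cw]]]]].
  exists (u + v), w; rewrite addrA; split=> //.
  by apply/lt_fuzzy_sum => //; exists u, v.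
move=> [_ [w [-> /lt_fuzzy_sum[]// u [v [-> au bv]] cw]]].
exists u, (v + w); rewrite addrA; split=> //.
by apply/lt_fuzzy_sum => //; exists v, w.
Qed.

Lemma fuzzy_add0 a : normal_fuzzy a -> fuzzy_sum R S (fuzzy_theta R S) a = a.
Proof.
move=> Na; have [Fa _] := Na; have [Ft _] := fuzzy_theta_normal.
apply: fuzzy_ext => // [|t x t0].
  by have [] := fuzzy_sum_normal fuzzy_theta_normal Na.
rewrite lt_fuzzy_sum//; split=> [[_ [v [-> /lt_fuzzy_theta[]// -> _]]]|ax].
  by rewrite add0r.
exists 0, x; rewrite add0r; split=> //; apply/lt_fuzzy_theta => //; split=> //.
(* The remaining bound [t < 1], needed for [0] to lie in the level set of [fuzzy_theta], comes from
   [t < a x <= 1]. *)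
by have /andP[_] := Fa x; exact: lt_le_trans.
Qed.

Lemma fuzzy_compA a b c : normal_fuzzy a -> normal_fuzzy b -> normal_fuzzy c ->
  fuzzy_comp R op a (fuzzy_comp R op b c) =
  fuzzy_comp R op (fuzzy_comp R op a b) c.
Proof.
move=> Na Nb Nc; have [[Fa _] [Fb _] [Fc _]] := And3 Na Nb Nc.
have Nbc := fuzzy_comp_normal Nb Nc; have Nab := fuzzy_comp_normal Na Nb.
have [[Fbc _] [Fab _]] := (Nbc, Nab).
have [Fl _] := fuzzy_comp_normal Na Nbc.
have [Fr _] := fuzzy_comp_normal Nab Nc.
apply: fuzzy_ext => // t x t0; rewrite !lt_fuzzy_comp//.
(* The level characterization is recast as an equality of sets, so that it can be rewritten inside
   the arguments of [sums_of_products]. *)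
have level a' b' : fuzzy_subset a' -> fuzzy_subset b' ->
    [set y | t < fuzzy_comp R op a' b' y] =
    sums_of_products [set u | t < a' u] [set v | t < b' v].
  by move=> Fa' Fb'; apply/seteqP; split=> y /lt_fuzzy_comp; apply.
by rewrite !level// sums_of_productsA.
Qed.

(** The decomposition [x = x + 0] works because [b 0 = 1]. This bound drives distributivity,
    zero-sum freeness and the infinite element. *)
Lemma le_fuzzy_suml a b x : normal_fuzzy a -> normal_fuzzy b ->
  a x <= fuzzy_sum R S a b x.
Proof.
move=> Na Nb; have [[Fa _] [Fb b0]] := (Na, Nb).
have [Fab _] := fuzzy_sum_normal Na Nb.
apply: le_level => [|t t0 ax]; first by have /andP[] := Fab x.
apply/lt_fuzzy_sum => //; exists x, 0; rewrite addr0 b0; split=> //.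
by have /andP[_] := Fa x; exact: lt_le_trans.
Qed.

Lemma le_fuzzy_sumr a b x : normal_fuzzy a -> normal_fuzzy b ->
  b x <= fuzzy_sum R S a b x.
Proof. by move=> Na Nb; rewrite fuzzy_sumC; exact: le_fuzzy_suml. Qed.

(** Left to right, each product is split by distributivity and the pieces are regrouped into two
    sums. Right to left, [a] and [b] both lie below their fuzzy sum, and sums of products are
    monotone in the factor sets. *)
Lemma fuzzy_compDl a b c : normal_fuzzy a -> normal_fuzzy b -> normal_fuzzy c ->
  fuzzy_comp R op (fuzzy_sum R S a b) c =
  fuzzy_sum R S (fuzzy_comp R op a c) (fuzzy_comp R op b c).
Proof.
move=> Na Nb Nc; have [[Fa _] [Fb _] [Fc _]] := And3 Na Nb Nc.
have Nab := fuzzy_sum_normal Na Nb.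
have Nac := fuzzy_comp_normal Na Nc; have Nbc := fuzzy_comp_normal Nb Nc.
have [[Fab _] [Fac _] [Fbc _]] := And3 Nab Nac Nbc.
have [Fl _] := fuzzy_comp_normal Nab Nc.
have [Fr _] := fuzzy_sum_normal Nac Nbc.
apply: fuzzy_ext => // t x t0; rewrite lt_fuzzy_comp// lt_fuzzy_sum//; split.
  elim=> {x} [_ d w /lt_fuzzy_sum[]// u [v [-> au bv]] cw|].
    exists (op u d w), (op v d w).
    by rewrite (gamma_opDl (gamma_with_zero_semiring hS)); split=> //;
      apply/lt_fuzzy_comp => //; exact: sums_of_products1.
  move=> x y _ [u [v [-> /lt_fuzzy_comp Pu /lt_fuzzy_comp Pv]]].
  move=> _ [u' [v' [-> /lt_fuzzy_comp Pu' /lt_fuzzy_comp Pv']]].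
  exists (u + u'), (v + v'); rewrite addrACA; split=> //;
    apply/lt_fuzzy_comp => //; apply: sums_of_productsD.
  - exact: Pu.
  - exact: Pu'.
  - exact: Pv.
  - exact: Pv'.
move=> [u [v [-> /lt_fuzzy_comp Pu /lt_fuzzy_comp Pv]]].
apply: sums_of_productsD.
  apply: sums_of_productsS (Pu _ _ _) => // y /= ay.
  by apply: lt_le_trans ay _; exact: le_fuzzy_suml.
apply: sums_of_productsS (Pv _ _ _) => // y /= ay.
by apply: lt_le_trans ay _; exact: le_fuzzy_sumr.
Qed.

Lemma fuzzy_compDr a b c : normal_fuzzy a -> normal_fuzzy b -> normal_fuzzy c ->
  fuzzy_comp R op a (fuzzy_sum R S b c) =
  fuzzy_sum R S (fuzzy_comp R op a b) (fuzzy_comp R op a c).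
Proof.
move=> Na Nb Nc; have [[Fa _] [Fb _] [Fc _]] := And3 Na Nb Nc.
have Nbc := fuzzy_sum_normal Nb Nc.
have Nab := fuzzy_comp_normal Na Nb; have Nac := fuzzy_comp_normal Na Nc.
have [[Fbc _] [Fab _] [Fac _]] := And3 Nbc Nab Nac.
have [Fl _] := fuzzy_comp_normal Na Nbc.
have [Fr _] := fuzzy_sum_normal Nab Nac.
apply: fuzzy_ext => // t x t0; rewrite lt_fuzzy_comp// lt_fuzzy_sum//; split.
  elim=> {x} [w d _ aw /lt_fuzzy_sum[]// u [v [-> bu cv]]|].
    exists (op w d u), (op w d v).
    by rewrite (gamma_opDr (gamma_with_zero_semiring hS)); split=> //;
      apply/lt_fuzzy_comp => //; exact: sums_of_products1.
  move=> x y _ [u [v [-> /lt_fuzzy_comp Pu /lt_fuzzy_comp Pv]]].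
  move=> _ [u' [v' [-> /lt_fuzzy_comp Pu' /lt_fuzzy_comp Pv']]].
  exists (u + u'), (v + v'); rewrite addrACA; split=> //;
    apply/lt_fuzzy_comp => //; apply: sums_of_productsD.
  - exact: Pu.
  - exact: Pu'.
  - exact: Pv.
  - exact: Pv'.
move=> [u [v [-> /lt_fuzzy_comp Pu /lt_fuzzy_comp Pv]]].
apply: sums_of_productsD.
  apply: sums_of_productsS (Pu _ _ _) => // y /= ay.
  by apply: lt_le_trans ay _; exact: le_fuzzy_suml.
apply: sums_of_productsS (Pv _ _ _) => // y /= ay.
by apply: lt_le_trans ay _; exact: le_fuzzy_sumr.
Qed.

(** Since [a 0 = 1] already puts [0] in every level set with [t < 1], only the inclusion of the
    level sets in the singleton of [0] has to be checked. *)
Lemma normal_fuzzy_eq_theta a : normal_fuzzy a ->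
  (forall t x, 0 <= t -> t < a x -> x = 0) -> a = fuzzy_theta R S.
Proof.
move=> [Fa a0] ax0; have [Ft _] := fuzzy_theta_normal.
apply: fuzzy_ext => // t x t0; rewrite lt_fuzzy_theta//.
split=> [ax|[-> t1]]; last by rewrite a0.
split; first exact: ax0 ax.
by have /andP[_] := Fa x; exact: lt_le_trans.
Qed.

Lemma fuzzy_comp0l a : normal_fuzzy a ->
  fuzzy_comp R op (fuzzy_theta R S) a = fuzzy_theta R S.
Proof.
move=> Na; have [Fa _] := Na; have [Ft _] := fuzzy_theta_normal.
apply: normal_fuzzy_eq_theta => [|t x t0].
  exact: fuzzy_comp_normal fuzzy_theta_normal Na.
rewrite lt_fuzzy_comp//; elim=> {x} [u c v /lt_fuzzy_theta[]// -> _ _|].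
  exact: gamma_op0l.
by move=> x y _ -> _ ->; rewrite addr0.
Qed.

Lemma fuzzy_comp0r a : normal_fuzzy a ->
  fuzzy_comp R op a (fuzzy_theta R S) = fuzzy_theta R S.
Proof.
move=> Na; have [Fa _] := Na; have [Ft _] := fuzzy_theta_normal.
apply: normal_fuzzy_eq_theta => [|t x t0].
  exact: fuzzy_comp_normal Na fuzzy_theta_normal.
rewrite lt_fuzzy_comp//; elim=> {x} [u c v _ /lt_fuzzy_theta[]// -> _|].
  exact: gamma_op0r.
by move=> x y _ -> _ ->; rewrite addr0.
Qed.

(** * Zero-sum freeness, the infinite element, and assembly of the laws *)

Lemma fuzzy_sum_eq_theta a b : normal_fuzzy a -> normal_fuzzy b ->
  fuzzy_sum R S a b = fuzzy_theta R S -> a = fuzzy_theta R S.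
Proof.
move=> Na Nb ab0; apply: normal_fuzzy_eq_theta => // t x t0 ax.
have := lt_le_trans ax (le_fuzzy_suml x Na Nb).
by rewrite ab0 => /lt_fuzzy_theta[].
Qed.

Lemma fuzzy_sum_one a : normal_fuzzy a ->
  fuzzy_sum R S (fuzzy_one R S) a = fuzzy_one R S.
Proof.
move=> Na; have [Fs _] := fuzzy_sum_normal fuzzy_one_normal Na.
apply/funext => x; apply/eqP; rewrite eq_le; have /andP[_ ->/=] := Fs x.
exact: le_fuzzy_suml fuzzy_one_normal Na.
Qed.

(** All identities are inherited from [normal_fuzzy], so a class of ideals only has to contain the
    two constants and be closed under both operations. *)
Lemma normal_fuzzy_hemiring (H : set (S -> R)) :
  H `<=` normal_fuzzy -> H (fuzzy_theta R S) -> H (fuzzy_one R S) ->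
  (forall a b, H a -> H b -> H (fuzzy_sum R S a b)) ->
  (forall a b, H a -> H b -> H (fuzzy_comp R op a b)) ->
  hemiring H (fuzzy_sum R S) (fuzzy_comp R op) (fuzzy_theta R S)
  /\ zero_sum_free H (fuzzy_sum R S) (fuzzy_theta R S)
  /\ infinite_element H (fuzzy_sum R S) (fuzzy_one R S).
Proof.
move=> HN H0 H1 HD HM; split; [split=> //|split; [|split=> //]].
- by move=> a b c /HN Na /HN Nb /HN Nc; exact: fuzzy_sumA.
- by move=> a b _ _; exact: fuzzy_sumC.
- by move=> a /HN; exact: fuzzy_add0.
- by move=> a b c /HN Na /HN Nb /HN Nc; exact: fuzzy_compA.
- by move=> a b c /HN Na /HN Nb /HN Nc; exact: fuzzy_compDl.
- by move=> a b c /HN Na /HN Nb /HN Nc; exact: fuzzy_compDr.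
- by move=> a /HN; exact: fuzzy_comp0l.
- by move=> a /HN; exact: fuzzy_comp0r.
- move=> a b /HN Na /HN Nb ab0; split; first exact: fuzzy_sum_eq_theta ab0.
  by apply: (fuzzy_sum_eq_theta Nb Na); rewrite fuzzy_sumC.
- by move=> s /HN; exact: fuzzy_sum_one.
Qed.

(** * Fuzzy ideals described by their level sets *)

Definition level_closedD mu := forall t x y, 0 <= t ->
  t < mu x -> t < mu y -> t < mu (x + y).

Lemma level_closedDP mu : fuzzy_subset mu ->
  level_closedD mu <-> forall x y, mu (x + y) >= Num.min (mu x) (mu y).
Proof.
move=> Fmu; split=> [Dmu x y|Dmu t x y _ tx ty].
  apply: le_level => [|t t0]; first by have /andP[] := Fmu (x + y).
  by rewrite lt_min => /andP[]; exact: Dmu.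
by apply: lt_le_trans (Dmu x y); rewrite lt_min tx ty.
Qed.

Lemma FLIP mu : FLI R op mu <->
  [/\ normal_fuzzy mu, level_closedD mu &
      forall t x c y, 0 <= t -> t < mu y -> t < mu (op x c y)].
Proof.
split=> [[[Fmu _ Dmu Mmu] mu0]|[[Fmu mu0] Dmu Mmu]].
  split=> //; first exact/level_closedDP.
  by move=> t x c y _ ty; exact: lt_le_trans (Mmu x c y).
split=> //; split=> //.
(* The normalization [mu 0 = 1] makes [0] a witness of nonemptiness. *)
- by exists 0; rewrite mu0; apply/eqP; exact: oner_neq0.
- exact/level_closedDP.
- move=> x c y; apply: le_level => [|t t0]; last exact: Mmu.
  by have /andP[] := Fmu (op x c y).
Qed.

Lemma FRIP mu : FRI R op mu <->
  [/\ normal_fuzzy mu, level_closedD mu &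
      forall t x c y, 0 <= t -> t < mu x -> t < mu (op x c y)].
Proof.
split=> [[[Fmu _ Dmu Mmu] mu0]|[[Fmu mu0] Dmu Mmu]].
  split=> //; first exact/level_closedDP.
  by move=> t x c y _ ty; exact: lt_le_trans (Mmu x c y).
split=> //; split=> //.
- by exists 0; rewrite mu0; apply/eqP; exact: oner_neq0.
- exact/level_closedDP.
- move=> x c y; apply: le_level => [|t t0]; last exact: Mmu.
  by have /andP[] := Fmu (op x c y).
Qed.

Lemma fuzzy_theta_closedD : level_closedD (fuzzy_theta R S).
Proof.
move=> t x y t0 /lt_fuzzy_theta[]// -> t1 /lt_fuzzy_theta[]// -> _.
by apply/lt_fuzzy_theta => //; rewrite addr0.
Qed.

Lemma fuzzy_sum_closedD a b : fuzzy_subset a -> fuzzy_subset b ->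
  level_closedD a -> level_closedD b -> level_closedD (fuzzy_sum R S a b).
Proof.
move=> Fa Fb Da Db t x y t0 /lt_fuzzy_sum[]// u [v [-> au bv]].
move=> /lt_fuzzy_sum[]// u' [v' [-> au' bv']].
apply/lt_fuzzy_sum => //; exists (u + u'), (v + v').
by rewrite addrACA; split=> //; [exact: Da|exact: Db].
Qed.

(** The level sets are additively generated by products, hence closed under addition by
    construction. *)
Lemma fuzzy_comp_closedD a b : fuzzy_subset a -> fuzzy_subset b ->
  level_closedD (fuzzy_comp R op a b).
Proof.
by move=> Fa Fb t x y t0; rewrite !lt_fuzzy_comp//; exact: sums_of_productsD.
Qed.

(** * Closure of left and right ideals under the operations *)

Lemma FLI_theta : FLI R op (fuzzy_theta R S).
Proof.
apply/FLIP; split; [exact: fuzzy_theta_normal|exact: fuzzy_theta_closedD|].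
move=> t x c y t0 /lt_fuzzy_theta[]// -> t1.
by apply/lt_fuzzy_theta => //; rewrite (gamma_op0r hS).
Qed.

Lemma FRI_theta : FRI R op (fuzzy_theta R S).
Proof.
apply/FRIP; split; [exact: fuzzy_theta_normal|exact: fuzzy_theta_closedD|].
move=> t x c y t0 /lt_fuzzy_theta[]// -> t1.
by apply/lt_fuzzy_theta => //; rewrite (gamma_op0l hS).
Qed.

Lemma FLI_one : FLI R op (fuzzy_one R S).
Proof. by apply/FLIP; split=> //; exact: fuzzy_one_normal. Qed.

Lemma FRI_one : FRI R op (fuzzy_one R S).
Proof. by apply/FRIP; split=> //; exact: fuzzy_one_normal. Qed.

Lemma FLI_sum a b : FLI R op a -> FLI R op b -> FLI R op (fuzzy_sum R S a b).
Proof.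
move=> /FLIP[Na Da Ma] /FLIP[Nb Db Mb]; have [[Fa _] [Fb _]] := (Na, Nb).
apply/FLIP; split; [exact: fuzzy_sum_normal|exact: fuzzy_sum_closedD|].
move=> t x c y t0 /lt_fuzzy_sum[]// u [v [-> au bv]].
apply/lt_fuzzy_sum => //; exists (op x c u), (op x c v).
by rewrite (gamma_opDr (gamma_with_zero_semiring hS)); split=> //;
  [exact: Ma|exact: Mb].
Qed.

Lemma FRI_sum a b : FRI R op a -> FRI R op b -> FRI R op (fuzzy_sum R S a b).
Proof.
move=> /FRIP[Na Da Ma] /FRIP[Nb Db Mb]; have [[Fa _] [Fb _]] := (Na, Nb).
apply/FRIP; split; [exact: fuzzy_sum_normal|exact: fuzzy_sum_closedD|].
move=> t x c y t0 /lt_fuzzy_sum[]// u [v [-> au bv]].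
apply/lt_fuzzy_sum => //; exists (op u c y), (op v c y).
by rewrite (gamma_opDl (gamma_with_zero_semiring hS)); split=> //;
  [exact: Ma|exact: Mb].
Qed.

(** A left multiplier distributes over the sum and, by associativity, is absorbed by the first
    factor of each product, which stays in the level set of the left ideal [a]. *)
Lemma FLI_comp a b : FLI R op a -> FLI R op b -> FLI R op (fuzzy_comp R op a b).
Proof.
have [[_ opDr _ opA] _ _ _] := hS.
move=> /FLIP[Na Da Ma] /FLIP[Nb Db Mb]; have [[Fa _] [Fb _]] := (Na, Nb).
apply/FLIP; split; [exact: fuzzy_comp_normal|exact: fuzzy_comp_closedD|].
move=> t x c y t0; rewrite !lt_fuzzy_comp//.
elim=> {y} [u d v au bv|y z _ Py _ Pz].
  by rewrite opA; apply: sums_of_products1 => //; exact: Ma.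
by rewrite opDr; exact: sums_of_productsD.
Qed.

(** Mirror image: a right multiplier is absorbed by the second factor of each product, through the
    right ideal property of [b]. *)
Lemma FRI_comp a b : FRI R op a -> FRI R op b -> FRI R op (fuzzy_comp R op a b).
Proof.
have [[opDl _ _ opA] _ _ _] := hS.
move=> /FRIP[Na Da Ma] /FRIP[Nb Db Mb]; have [[Fa _] [Fb _]] := (Na, Nb).
apply/FRIP; split; [exact: fuzzy_comp_normal|exact: fuzzy_comp_closedD|].
move=> t x c y t0; rewrite !lt_fuzzy_comp//.
elim=> {x} [u d v au bv|x z _ Px _ Pz].
  by rewrite -opA; apply: sums_of_products1 => //; exact: Mb.
by rewrite opDl; exact: sums_of_productsD.
Qed.

End Fuzzy.

Theorem theorem3p12 (R : realType) (S G : nmodType) (op : S -> G -> S -> S)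
    (hS : gamma_semiring_with_zero op) (hu : with_unities op) :
  (hemiring (FLI R op) (fuzzy_sum R S) (fuzzy_comp R op) (fuzzy_theta R S)
   /\ zero_sum_free (FLI R op) (fuzzy_sum R S) (fuzzy_theta R S)
   /\ infinite_element (FLI R op) (fuzzy_sum R S) (fuzzy_one R S))
  /\
  (hemiring (FRI R op) (fuzzy_sum R S) (fuzzy_comp R op) (fuzzy_theta R S)
   /\ zero_sum_free (FRI R op) (fuzzy_sum R S) (fuzzy_theta R S)
   /\ infinite_element (FRI R op) (fuzzy_sum R S) (fuzzy_one R S)).
Proof.
split; apply: normal_fuzzy_hemiring => //.
- by move=> mu /FLIP[].
- exact: FLI_theta.
- exact: FLI_one.
- by move=> a b; exact: FLI_sum.
- by move=> a b; exact: FLI_comp.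
- by move=> mu /FRIP[].
- exact: FRI_theta.
- exact: FRI_one.
- by move=> a b; exact: FRI_sum.
- by move=> a b; exact: FRI_comp.
Qed.
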